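(* Suppose that a $3$-web $W_3$ is given locally by the web function $z=f(x,y)$. Then $W_3$ is linear if and only if $$f_y^2\,f_{xx}-2f_xf_y\,f_{xy}+f_x^2\,f_{yy}=0 .$$
   Context: Here $(x,y)$ are coordinates on a (simply connected) domain of the plane $\mathbb{R}^2$ and $f$ is a smooth function on this domain with $f_x\neq 0$ and $f_y\neq 0$ everywhere; subscripts denote partial derivatives. The $3$-web given by the web function $f$ consists of the three foliations by curves $\{x=\mathrm{const}\}$, $\{y=\mathrm{const}\}$, $\{f(x,y)=\mathrm{const}\}$, any two of which are transversal. The web is linear if the leaves of all three foliations are (pieces of) straight lines in the $(x,y)$-plane. *)

(* Defs.v *)
From mathcomp Require Import all_boot all_order all_algebra.
From mathcomp Require Import all_classical all_reals all_analysis.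
Set Implicit Arguments.
Unset Strict Implicit.
Unset Printing Implicit Defensive.
Import Order.TTheory GRing.Theory Num.Theory numFieldNormedType.Exports.
Local Open Scope classical_set_scope.
Local Open Scope ring_scope.

(* The coordinate plane is R * R, with the product topology. *)
Section Webs.
Variable R : realType.
Implicit Types (D L : set (R * R)) (f u : R * R -> R).

Definition pdx f : R * R -> R := 'D_((1, 0) : R * R) f.
Definition pdy f : R * R -> R := 'D_((0, 1) : R * R) f.

(* Class C^n on D, for D open: a partial derivative at a point of D only
   depends on the restriction of the function to D. *)
Fixpoint Cn (n : nat) D f : Prop :=
  {in D, continuous f} /\
  if n is m.+1 then
    [/\ forall p, D p ->
          derivable f p ((1, 0) : R * R) /\ derivable f p ((0, 1) : R * R),
        Cn m D (pdx f) & Cn m D (pdy f)]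
  else True.

Definition smooth D f := forall n, Cn n D f.

(* Every loop g in D is homotopic in D, relative to its base point, to a
   constant loop; only the values of g on [0, 1] and of H on [0, 1]^2 matter. *)
Definition null_homotopic_loops D :=
  forall g : R -> R * R,
    {within `[0, 1], continuous g} -> (forall t : R, t \in `[0, 1] -> D (g t)) ->
    g 0 = g 1 ->
  exists H : R * R -> R * R,
    [/\ {within `[0, 1] `*` `[0, 1], continuous H},
        forall s t : R, s \in `[0, 1] -> t \in `[0, 1] -> D (H (s, t)),
        forall t : R, t \in `[0, 1] -> H (0, t) = g t /\ H (1, t) = g 0
      & forall s : R, s \in `[0, 1] -> H (s, 0) = g 0 /\ H (s, 1) = g 0].

Definition simply_connected_domain D :=
  [/\ D !=set0, open D, connected D & null_homotopic_loops D].

(* A foliation is given by the set of its leaves. *)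
Definition foliation := set (set (R * R)).

(* The foliation {u = const} of D: since u will be a submersion, its leaves
   are the connected components of the level sets of u in D. *)
Definition level_foliation D u : foliation :=
  [set connected_component (D `&` [set q | u q = u p]) p | p in D].

Definition three_web := (foliation * foliation * foliation)%type.

Definition web_of D f : three_web :=
  (level_foliation D fst, level_foliation D snd, level_foliation D f).

(* A nonempty open interval (possibly unbounded) of a straight line. *)
Definition line_piece L :=
  exists (p v : R * R) (I : set R),
    [/\ v != 0, I !=set0, open I, is_interval I
      & L = [set p + t *: v | t in I]].

Definition linear_foliation (F : foliation) := forall L, F L -> line_piece L.

Definition linear_web (W : three_web) :=
  [/\ linear_foliation W.1.1, linear_foliation W.1.2 & linear_foliation W.2].

End Webs.

(* Main.v *)
Require Import Defs.
From mathcomp Require Import all_boot all_order all_algebra.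
From mathcomp Require Import all_classical all_reals all_analysis.
From mathcomp Require Import ring lra.
Import Order.TTheory GRing.Theory Num.Theory numFieldNormedType.Exports.
Local Open Scope classical_set_scope.
Local Open Scope ring_scope.

(** Write fx, fy for the first partial derivatives of f and F for the left-hand
side fy^2 fxx - 2 fx fy fxy + fx^2 fyy, called [flex] below: it is the second
derivative of f in the direction (fy, -fx) tangent to the level curve, so it
vanishes exactly where that curve has zero curvature.

The lines x = const and y = const are straight, so only the third foliation
matters.

If the leaf of f through p is a piece of a line with direction v, then f is
constant along that line near p. Its first derivative along the line,
v1 fx + v2 fy, vanishes there, which makes v proportional to (fy, -fx); its
second derivative v1^2 fxx + 2 v1 v2 fxy + v2^2 fyy vanishes as well, and this
is F up to a nonzero factor ([flex_eq0]).

Conversely, let F = 0, fix p and move along the line p + t v with v the tangent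
direction at p. The derivative phi(t) = v1 fx + v2 fy of f along this line is
zero at t = 0, and F = 0 turns phi' into a continuous multiple of phi; hence
phi = 0 by uniqueness for linear differential equations
([derivative_zero_along_chord]) and f is constant on the part of the line that
is connected to p inside the domain D, the chord ([const_along_chord]).

It remains to see that the chord is the whole leaf. Near a point of the
chord every point of D at the same level lies on the line, because f is
strictly monotone in y ([level_near_chord]); so the chord is open in the level
set. It is also closed there, and connected, hence it is a connected component
([level_component_chord]).

The equation for phi' mixes the two orders of differentiation, so the symmetry
of second partial derivatives ([mixed_partials]) is proved first, together with
the formula for directional derivatives of a C^1 function
([C1_is_derive]). *)

Set Implicit Arguments.
Unset Strict Implicit.
Unset Printing Implicit Defensive.

(** * Directional and mixed derivatives in the plane *)

Section Calculus.
Variable R : realType.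
Implicit Types (D : set (R * R)) (g : R * R -> R) (p q u v w : R * R).

(** The increment k may have either sign, which avoids ordering the end points
in every use; the price is that the intermediate point is only located in
[-|k|, |k|]. *)
Lemma mean_value_from0 (f df : R -> R) (k : R) :
  (forall s : R, `|s| <= `|k| -> is_derive s 1 f (df s)) ->
  exists2 s, `|s| <= `|k| & f k - f 0 = k * df s.
Proof.
move=> dfE.
have [k0|/ltW k0] := leP 0 k.
- have sub s : s \in `[0, k] -> `|s| <= `|k|.
    by rewrite in_itv/= => /andP[s0 sk]; rewrite !ger0_norm.
  have [||c ck ->] := @MVT_segment R f df 0 k k0.
  + by move=> x /subset_itv_oo_cc; move=> /sub; exact: dfE.
  + apply: derivable_within_continuous => x /sub xk.
    by have [] := dfE _ xk.
  by exists c; [exact: sub|rewrite subr0 mulrC].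
- have sub s : s \in `[k, 0] -> `|s| <= `|k|.
    by rewrite in_itv/= => /andP[ks s0]; rewrite !ler0_norm// lerN2.
  have [||c ck /eqP E] := @MVT_segment R f df k 0 k0.
  + by move=> x /subset_itv_oo_cc; move=> /sub; exact: dfE.
  + apply: derivable_within_continuous => x /sub xk.
    by have [] := dfE _ xk.
  exists c; first exact: sub.
  by rewrite -opprB (eqP E) sub0r mulrN opprK mulrC.
Qed.

Lemma is_derive_along g q v (t : R) :
  derivable g (q + t *: v) v ->
  is_derive t 1 (fun s : R => g (q + s *: v)) ('D_v g (q + t *: v)).
Proof.
move=> dg.
have E : (fun h : R => h^-1 *: (((fun s : R => g (q + s *: v)) \o shift t) (h *: 1) -
             g (q + t *: v))) =
         (fun h : R => h^-1 *: ((g \o shift (q + t *: v)) (h *: v) - g (q + t *: v))).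
  apply/funext => h /=; congr (_ *: (g _ - _)).
  by rewrite scalerDl addrCA [h *: 1]mulr1.
by split; rewrite /derivable /derive E.
Qed.

(** Applying the mean value theorem first to the difference of two parallel
restrictions of g and then to the inner increment. The left-hand side is
symmetric in u and w, which is what makes mixed derivatives commute. *)
Lemma second_difference g q u w (k : R) :
  (forall s r : R, `|s| <= `|k| -> `|r| <= `|k| ->
    derivable g (q + r *: w + s *: u) u /\
    derivable ('D_u g) (q + s *: u + r *: w) w) ->
  exists s r : R, [/\ `|s| <= `|k|, `|r| <= `|k| &
    g (q + k *: w + k *: u) - g (q + k *: u) - (g (q + k *: w) - g q)
    = k ^+ 2 * 'D_w ('D_u g) (q + s *: u + r *: w)].
Proof.
move=> dg.
have [|s sk E1] := @mean_value_from0
  (fun s : R => g (q + k *: w + s *: u) - g (q + s *: u))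
  (fun s : R => 'D_u g (q + k *: w + s *: u) - 'D_u g (q + s *: u)) k; last first.
  have [|r rk E2] := @mean_value_from0
    (fun r : R => 'D_u g (q + s *: u + r *: w))
    (fun r : R => 'D_w ('D_u g) (q + s *: u + r *: w)) k; last first.
    exists s, r; split => //.
    move: E1 E2; rewrite !scale0r !addr0 => ->.
    by rewrite addrAC => ->; rewrite mulrA.
  by move=> r rk; apply: is_derive_along; have [] := dg _ _ sk rk.
move=> s sk; apply: is_deriveB; apply: is_derive_along.
  by have [] := dg _ _ sk (lexx _).
have := dg s 0 sk; rewrite normr0 scale0r addr0 => /(_ (normr_ge0 _)).
by case.
Qed.


Lemma near_box D q : nbhs q D ->
  exists2 d : R, 0 < d &
    forall a b : R, `|a| < d -> `|b| < d -> D (q + (a, b)).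
Proof.
move=> /nbhs_normP[d /= d0 De]; exists d => // a b ad bd.
apply: De; rewrite /ball_ /= opprD addrA subrr sub0r normrN prod_normE /=.
by rewrite gt_max ad bd.
Qed.

Lemma continuous_box D g1 g2 q (e : R) : nbhs q D ->
  {for q, continuous g1} -> {for q, continuous g2} -> 0 < e ->
  exists2 d : R, 0 < d &
    forall a b : R, `|a| < d -> `|b| < d ->
      [/\ D (q + (a, b)), `|g1 q - g1 (q + (a, b))| < e
         & `|g2 q - g2 (q + (a, b))| < e].
Proof.
move=> nD /cvgrPdist_lt n1 /cvgrPdist_lt n2 e0.
have : \forall p \near q, [/\ D p, `|g1 q - g1 p| < e & `|g2 q - g2 p| < e].
  by apply: filterS3 nD (n1 _ e0) (n2 _ e0) => p; split.
exact: near_box.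
Qed.

Lemma Cn_partials n D g : Cn n.+1 D g -> Cn n D (pdx g) /\ Cn n D (pdy g).
Proof. by case=> _ []. Qed.

Lemma Cn_continuous n D g q : Cn n D g -> D q -> {for q, continuous g}.
Proof. by case: n => [|n] [gc _] Dq; apply: gc; rewrite inE. Qed.

Lemma Cn_derivable n D g q : Cn n.+1 D g -> D q ->
  derivable g q ((1, 0) : R * R) /\ derivable g q ((0, 1) : R * R).
Proof. by case=> _ [gd _ _] Dq; exact: gd. Qed.

(** The increment of g from q to q + h v is split into a horizontal and a
vertical step. The mean value theorem turns each step into a partial
derivative at a point close to q, and continuity of the partial derivatives
lets h tend to 0. *)
Lemma C1_is_derive D g q v : open D -> Cn 1 D g -> D q ->
  is_derive q v g (v.1 * pdx g q + v.2 * pdy g q).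
Proof.
move=> oD gC1 Dq; have nD : nbhs q D by apply: open_nbhs_nbhs.
have [xC yC] := Cn_partials gC1.
have xc := Cn_continuous xC Dq; have yc := Cn_continuous yC Dq.
suff : h^-1 *: ((g \o shift q) (h *: v) - g q) @[h --> 0^'] -->
    v.1 * pdx g q + v.2 * pdy g q.
  by move=> cg; split; [exact: cvgP cg|exact: cvg_lim cg].
apply/cvgrPdist_lt => e e0.
(* The summand 1 keeps m positive when v = 0. *)
pose m := `|v.1| + `|v.2| + 1.
have m0 : 0 < m by rewrite ltr_wpDl// addr_ge0.
have em0 : 0 < e / m by rewrite divr_gt0.
have [d d0 Hd] := continuous_box nD xc yc em0.
have dm0 : 0 < d / m by rewrite divr_gt0.
near=> h.
have h0 : h != 0 by near: h; exact: nbhs_dnbhs_neq.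
have hd : `|h| < d / m by near: h; exact: dnbhs0_lt.
have hm (c : R) : `|c| <= m -> `|h * c| < d.
  move=> cm; rewrite normrM.
  by rewrite (le_lt_trans (ler_wpM2l _ cm))// -ltr_pdivlMr.
have hv1 : `|h * v.1| < d by apply: hm; rewrite /m -addrA lerDl addr_ge0.
have hv2 : `|h * v.2| < d by apply: hm; rewrite /m addrAC lerDr addr_ge0.
have n0 : `|0 : R| < d by rewrite normr0.
have tox (a b s : R) : q + (a, b) + s *: ((1, 0) : R * R) = q + (a + s, b).
  by case: (q) => ? ?; congr pair; rewrite /= ?scaler0 ?addr0// [s *: _]mulr1 addrA.
have toy (a b s : R) : q + (a, b) + s *: ((0, 1) : R * R) = q + (a, b + s).
  by case: (q) => ? ?; congr pair; rewrite /= ?scaler0 ?addr0// [s *: _]mulr1 addrA.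
have [|s sk E1] := @mean_value_from0
  (fun s : R => g (q + (0, h * v.2) + s *: (1, 0)))
  (fun s : R => pdx g (q + (0, h * v.2) + s *: (1, 0))) (h * v.1).
  move=> s sk; apply: is_derive_along; rewrite tox add0r.
  have [Ds _ _] := Hd s (h * v.2) (le_lt_trans sk hv1) hv2.
  exact: (Cn_derivable gC1 Ds).1.
have [|r rk E2] := @mean_value_from0
  (fun s : R => g (q + (0, 0) + s *: (0, 1)))
  (fun s : R => pdy g (q + (0, 0) + s *: (0, 1))) (h * v.2).
  move=> r rk; apply: is_derive_along; rewrite toy add0r.
  have [Ds _ _] := Hd 0 r n0 (le_lt_trans rk hv2).
  exact: (Cn_derivable gC1 Ds).2.
have q0 : q + (0, 0) = q by rewrite addr0.
move: E1 E2; rewrite !tox !toy !add0r ?q0.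
have [_ + _] := Hd s (h * v.2) (le_lt_trans sk hv1) hv2.
have [_ _] := Hd 0 r n0 (le_lt_trans rk hv2).
move=> Ey Ex E1 E2.
have -> : h^-1 *: ((g \o shift q) (h *: v) - g q) =
    v.1 * pdx g (q + (s, h * v.2)) + v.2 * pdy g (q + (0, r)).
  rewrite /= [_ *: v + q]addrC.
  have -> : h *: v = (h * v.1, h * v.2) by [].
  rewrite -[g _](subrK (g (q + (0, h * v.2)))) E1.
  rewrite -addrA E2 [_ *: _]mulrDr !mulrA mulVf// !mul1r.
  by [].
rewrite opprD addrACA -!mulrBr.
apply: (le_lt_trans (ler_normD _ _)); rewrite !normrM.
apply: (@le_lt_trans _ _ (`|v.1| * (e / m) + `|v.2| * (e / m))).
  by apply: lerD; apply: ler_wpM2l => //; exact: ltW.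
rewrite -mulrDl mulrCA -[ltRHS]mulr1 ltr_pM2l// ltr_pdivrMr// mul1r.
by rewrite /m ltrDl.
Unshelve. all: by end_near. Qed.

Lemma eq_of_common_approx (a b : R) :
  (forall e : R, 0 < e -> exists2 c, `|a - c| < e & `|b - c| < e) -> a = b.
Proof.
move=> ab; apply/eqP; rewrite -subr_eq0 -normr_le0 -[leRHS]add0r.
apply/ler_addgt0Pr => e e0; rewrite add0r.
have e20 : 0 < e / 2 by rewrite divr_gt0.
have [c] := ab _ e20.
rewrite !ltr_norml ler_norml => /andP[? ?] /andP[? ?].
by apply/andP; split; lra.
Qed.

(** Both mixed derivatives, taken at suitable points of an arbitrarily small
square at q, equal the same second difference divided by k^2; their
continuity does the rest. *)
Lemma mixed_partials D g q : open D -> Cn 2 D g -> D q ->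
  pdy (pdx g) q = pdx (pdy g) q.
Proof.
move=> oD gC2 Dq; have nD : nbhs q D by apply: open_nbhs_nbhs.
have [xC yC] := Cn_partials gC2.
have [_ xyC] := Cn_partials xC; have [yxC _] := Cn_partials yC.
have xyc := Cn_continuous xyC Dq; have yxc := Cn_continuous yxC Dq.
apply: eq_of_common_approx => e e0.
have [d d0 Hd] := continuous_box nD xyc yxc e0.
pose k := d / 2.
have k0 : 0 < k by rewrite divr_gt0.
have kd (s : R) : `|s| <= `|k| -> `|s| < d.
  move=> sk; apply: (le_lt_trans sk).
  by rewrite gtr0_norm// /k ltr_pdivrMr// ltr_pMr// ltr1n.
have toxy (s r : R) :
    q + s *: ((1, 0) : R * R) + r *: ((0, 1) : R * R) = q + (s, r).
  by case: (q) => a b; congr pair;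
    rewrite /= ?scaler0 ?addr0// ?[s *: _]mulr1 // [r *: _]mulr1.
have toyx (s r : R) :
    q + r *: ((0, 1) : R * R) + s *: ((1, 0) : R * R) = q + (s, r).
  by rewrite addrAC toxy.
have [|s [r [sk rk E1]]] :=
    @second_difference g q ((1, 0) : R * R) ((0, 1) : R * R) k.
  move=> s r sk rk; rewrite toxy toyx; have [Ds _ _] := Hd s r (kd _ sk) (kd _ rk).
  by split; [exact: (Cn_derivable gC2 Ds).1|exact: (Cn_derivable xC Ds).2].
have [|r' [s' [rk' sk' E2]]] :=
    @second_difference g q ((0, 1) : R * R) ((1, 0) : R * R) k.
  move=> r' s' rk' sk'; rewrite toxy toyx.
  have [Ds _ _] := Hd s' r' (kd _ sk') (kd _ rk').
  by split; [exact: (Cn_derivable gC2 Ds).2|exact: (Cn_derivable yC Ds).1].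
have E : pdy (pdx g) (q + (s, r)) = pdx (pdy g) (q + (s', r')).
  have kk : k ^+ 2 != 0 by rewrite expf_neq0// gt_eqF.
  move: E1 E2; rewrite !toxy !toyx => E1 E2.
  by apply: (mulfI kk); rewrite -[LHS]E1 -[RHS]E2; ring.
have [_ + _] := Hd s r (kd _ sk) (kd _ rk).
have [_ _] := Hd s' r' (kd _ sk') (kd _ rk').
rewrite E => yx_close xy_close.
by exists (pdx (pdy g) (q + (s', r'))).
Qed.

End Calculus.

(** * Uniqueness for homogeneous linear differential equations *)

Section LinearODE.
Variable R : realType.
Implicit Types (phi a : R -> R) (t T : R).

(** If M bounds a on [0, T], then phi^2 exp(- 2 M t) has the derivative
2 (a - M) phi^2 exp(- 2 M t) <= 0, so it stays below its initial value 0. *)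
Lemma linear_ode_zero_ge0 phi a T : 0 <= T ->
  (forall t, 0 <= t <= T -> is_derive t 1 phi (a t * phi t)) ->
  (forall t, 0 <= t <= T -> {for t, continuous a}) ->
  phi 0 = 0 -> phi T = 0.
Proof.
move=> T0 dphi ca phi0.
have wca : {within `[0, T], continuous a}.
  by apply: continuous_in_subspaceT => t; rewrite inE/= in_itv/=; exact: ca.
have [c cT aM] := EVT_max T0 wca.
pose M := a c.
pose psi := (phi ^+ 2 * (fun t => expR (- (2 * M) * t))) : R -> R.
pose dpsi t := 2 * (a t - M) * (phi t ^+ 2 * expR (- (2 * M) * t)).
have dpsiE t : 0 <= t <= T -> is_derive t 1 psi (dpsi t).
  move=> tT; have ? := dphi t tT.
  have ? : is_derive t 1 (fun t : R => - (2 * M) * t) (- (2 * M)).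
    by apply: is_derive_eq; rewrite ?scaler1.
  have ? : is_derive t 1 (expR \o (fun t : R => - (2 * M) * t))
     (expR (- (2 * M) * t) * - (2 * M)).
    exact: is_derive1_comp.
  apply: is_derive_eq.
  by rewrite /dpsi /GRing.scale /= -[(phi ^+ 2) t]/(phi t ^+ 2); ring.
have [||s sT] := @MVT_segment R psi dpsi 0 T T0.
- by move=> t /subset_itv_oo_cc; rewrite in_itv/=; exact: dpsiE.
- apply: derivable_within_continuous => t; rewrite in_itv/= => /dpsiE.
  by case.
have -> : psi 0 = 0 by rewrite /psi /= !fctE phi0 expr0n mul0r.
rewrite !subr0 => psiT.
have psi_le0 : psi T <= 0.
  rewrite psiT mulr_le0_ge0// /dpsi mulr_le0_ge0//; last first.
    by rewrite mulr_ge0 ?sqr_ge0// expR_ge0.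
  by rewrite mulr_ge0_le0// subr_le0; exact: aM.
have : phi T ^+ 2 <= 0.
  by rewrite -(pmulr_lle0 _ (expR_gt0 (- (2 * M) * T))).
by move=> h; apply/eqP; rewrite -sqrf_eq0 eq_le h sqr_ge0.
Qed.

(** Negative times reduce to positive ones by reversing t. *)
Lemma linear_ode_zero phi a (I : set R) T : is_interval I -> I 0 -> I T ->
  (forall t, I t -> is_derive t 1 phi (a t * phi t)) ->
  (forall t, I t -> {for t, continuous a}) ->
  phi 0 = 0 -> phi T = 0.
Proof.
move=> iI I0 IT dphi ca phi0.
have [T0|/ltW T0] := leP 0 T.
  have sub t : 0 <= t <= T -> I t by exact: iI.
  by apply: (@linear_ode_zero_ge0 phi a) => // t /sub; [exact: dphi|exact: ca].
have sub t : 0 <= t <= - T -> I (- t).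
  by move=> /andP[t0 tT]; apply: (iI T 0) => //; rewrite lerNr tT lerNl oppr0.
have dN t : is_derive t 1 (-%R : R -> R) (-1) by apply: is_derive_eq.
rewrite -[T]opprK; apply: (@linear_ode_zero_ge0 (phi \o -%R) (fun t => - a (- t))).
- by rewrite oppr_ge0.
- move=> t /sub It; have ? := dphi _ It.
  have ? := @is_derive1_comp R phi -%R t _ _ (dphi _ It) (dN t).
  by apply: is_derive_eq; rewrite /=; ring.
- move=> t /sub It; apply: continuousN.
  apply: continuous_comp; first exact: oppr_continuous.
  exact: ca.
- by rewrite /= oppr0.
Qed.

End LinearODE.

(** * Components of level sets along a line *)

Section LevelComponents.
Variable R : realType.
Implicit Types (D : set (R * R)) (u : R * R -> R) (p q v : R * R).

Lemma ball_sub_component (A : set R) (x t e : R) :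
  A x -> ball t e `<=` A -> ball t e `&` connected_component A x !=set0 ->
  ball t e `<=` connected_component A x.
Proof.
move=> Ax tA tI s ts.
have cU : connected (ball t e `|` connected_component A x).
  apply: connectedU => //; last exact: component_connected.
  by apply/connected_intervalP; rewrite ball_itv; exact: interval_is_interval.
apply: (connected_component_max _ _ cU); last by left.
  by right; exact: connected_component_refl.
by move=> r [/tA//|]; exact: connected_component_sub.
Qed.

Lemma open_component (A : set R) (x : R) : open A -> A x ->
  open (connected_component A x).
Proof.
move=> oA Ax; rewrite openE => t It.
have /nbhs_ballP[e /= e0 eA] : nbhs t A.
  by apply: open_nbhs_nbhs; split => //; exact: connected_component_sub It.
apply/nbhs_ballP; exists e => //; apply: ball_sub_component => //.
by exists t; split => //; exact: ballxx.
Qed.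

(** A component of an open set of reals is relatively closed in it: a ball around
a point of A that meets the component is absorbed by it. *)
Lemma open_setD_component (A : set R) (x : R) : open A -> A x ->
  open (A `\` connected_component A x).
Proof.
move=> oA Ax; rewrite openE => t [At It].
have /nbhs_ballP[e /= e0 eA] : nbhs t A by apply: open_nbhs_nbhs.
apply/nbhs_ballP; exists e => //= s ts; split; first exact: eA.
move=> Is; apply: It; apply: (ball_sub_component Ax eA).
  by exists s; split.
exact: ballxx.
Qed.

(** The parameter t of the orthogonal projection of q on the line p + t v. *)
Definition line_coord p v q : R :=
  ((q.1 - p.1) * v.1 + (q.2 - p.2) * v.2) / (v.1 ^+ 2 + v.2 ^+ 2).

(** Up to the factor |v|, the signed distance of q to the line p + t v. *)
Definition line_offset p v q : R := (q.1 - p.1) * v.2 - (q.2 - p.2) * v.1.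

Lemma sqr_norm_neq0 v : v != 0 -> v.1 ^+ 2 + v.2 ^+ 2 != 0.
Proof.
case: v => a b; rewrite /= paddr_eq0 ?sqr_ge0// !sqrf_eq0; apply: contra.
by move=> /andP[/eqP -> /eqP ->].
Qed.

Lemma line_coordK p v : v != 0 -> cancel (fun t => p + t *: v) (line_coord p v).
Proof.
move=> /sqr_norm_neq0; case: p v => [a b] [c d] /= n0 t.
rewrite /line_coord /= /GRing.scale /=; field; exact: n0.
Qed.

Lemma line_offset0 p v t : line_offset p v (p + t *: v) = 0.
Proof.
case: p v => [a b] [c d]; rewrite /line_offset /= /GRing.scale /=; ring.
Qed.

Lemma line_offset_eq0 p v q : v != 0 ->
  line_offset p v q = 0 -> p + line_coord p v q *: v = q.
Proof.
move=> /sqr_norm_neq0; case: p v q => [a b] [c d] [x y] /= n0.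
rewrite /line_offset /line_coord /= => /eqP; rewrite subr_eq0 => /eqP E.
congr pair; rewrite /= /GRing.scale /=; apply/eqP; rewrite -subr_eq0; apply/eqP.
  rewrite (_ : _ - x = - d * ((x - a) * d - (y - b) * c) / (c ^+ 2 + d ^+ 2)).
    by rewrite E subrr mulr0 mul0r.
  by field.
rewrite (_ : _ - y = c * ((x - a) * d - (y - b) * c) / (c ^+ 2 + d ^+ 2)).
  by rewrite E subrr mulr0 mul0r.
by field.
Qed.

Lemma continuous_line_coord p v : continuous (line_coord p v).
Proof.
move=> q; apply: cvgM; last exact: cvg_cst.
by apply: cvgD; (apply: cvgM; last exact: cvg_cst);
  (apply: cvgB; last exact: cvg_cst); [exact: cvg_fst|exact: cvg_snd].
Qed.

Lemma continuous_line_offset p v : continuous (line_offset p v).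
Proof.
move=> q; apply: cvgB; (apply: cvgM; last exact: cvg_cst);
  (apply: cvgB; last exact: cvg_cst); [exact: cvg_fst|exact: cvg_snd].
Qed.

Lemma continuous_line p v : continuous (fun t : R => p + t *: v).
Proof.
move=> t; apply: cvgD; first exact: cvg_cst.
by apply: cvgZl; exact: cvg_id.
Qed.

(** The parameters t of the points p + t v that are joined to p inside D by the
line itself; other pieces of the line in D may belong to other leaves. *)
Definition chord D p v := connected_component [set t : R | D (p + t *: v)] 0.

Lemma chord_sub D p v t : chord D p v t -> D (p + t *: v).
Proof. exact: connected_component_sub. Qed.

Lemma open_line_trace D p v : open D -> open [set t : R | D (p + t *: v)].
Proof.
by move=> oD; apply: open_comp oD => t _; exact: continuous_line.
Qed.

Lemma chord0 D p v : D p -> chord D p v 0.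
Proof.
by move=> Dp; apply: connected_component_refl => /=; rewrite scale0r addr0.
Qed.

Lemma open_chord D p v : open D -> D p -> open (chord D p v).
Proof.
move=> oD Dp; apply: open_component; first exact: open_line_trace.
by rewrite /= scale0r addr0.
Qed.

Lemma is_interval_chord D p v : is_interval (chord D p v).
Proof. by apply/connected_intervalP; exact: component_connected. Qed.

(** The image L of the chord is connected, and it is open and closed in the
level set S. Openness is the last hypothesis. For closedness, L consists of the
points of S on the line whose parameter avoids the other components of the
trace of D on the line, and these form an open set. So L is the whole
component. *)
Lemma level_component_chord D u p v : open D -> D p -> v != 0 ->
  (forall t, chord D p v t -> u (p + t *: v) = u p) ->
  (forall t, chord D p v t -> \forall q \near p + t *: v,
     D q -> u q = u p -> line_offset p v q = 0) ->
  connected_component (D `&` [set q | u q = u p]) p =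
  [set p + t *: v | t in chord D p v].
Proof.
move=> oD Dp v0 u_const u_line.
set S := D `&` _; set I := chord D p v; set L := [set _ | t in I].
have Lp : L p by exists 0; [exact: chord0|rewrite scale0r addr0].
have LS : L `<=` S.
  by move=> _ [t It <-]; split; [exact: chord_sub|exact: u_const].
have cL : connected L.
  apply: connected_continuous_connected; first exact: component_connected.
  by apply: continuous_subspaceT; exact: continuous_line.
pose A := [set t : R | D (p + t *: v)].
pose K := [set q | line_offset p v q = 0] `&`
          line_coord p v @^-1` (~` (A `\` I)).
have cK : closed K.
  apply: closedI.
    by apply: (@closed_comp _ _ (line_offset p v) [set 0]);
      [move=> q _; exact: continuous_line_offset|exact: closed_eq].
  apply: closed_comp; first by move=> q _; exact: continuous_line_coord.
  apply: open_closedC; apply: open_setD_component; first exact: open_line_trace.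
  by rewrite /A /= scale0r addr0.
have SK q : S q -> K q -> L q.
  move=> [Dq _] [/= /(line_offset_eq0 v0) qE nAI].
  exists (line_coord p v q) => //.
  by apply: contrapT => nI; apply: nAI; split => //; rewrite /A /= qE.
have LK : L `<=` K.
  move=> _ [t It <-]; split; first exact: line_offset0.
  by rewrite /= line_coordK// => -[].
pose O := [set q | \forall r \near q, S r -> L r]°.
have LO : L `<=` O.
  move=> _ [t It <-]; rewrite /O /interior /=; apply: nbhs_interior.
  have nI : \forall r \near p + t *: v, I (line_coord p v r).
    apply: continuous_line_coord; rewrite line_coordK//.
    by apply: open_nbhs_nbhs; split => //; exact: open_chord.
  apply: filterS2 (u_line t It) nI => r rL Ir [Dr ur].
  by exists (line_coord p v r) => //; exact: line_offset_eq0 (rL Dr ur).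
have OS q : O q -> S q -> L q.
  by move=> /interior_subset; move=> /nbhs_singleton; apply.
set C := connected_component S p.
have CS : C `<=` S by exact: connected_component_sub.
have LC : L `<=` C by exact: connected_component_max.
symmetry; apply: (@component_connected _ S p) => //.
- by exists p.
- exists O; first exact: open_interior.
  by apply/seteqP; split => [q Lq|q [/CS Sq Oq]]; [by split; [exact: LC|exact: LO]|exact: OS].
- exists K => //.
  by apply/seteqP; split => [q Lq|q [/CS Sq Kq]]; [by split; [exact: LC|exact: LK]|exact: SK].
Qed.

End LevelComponents.

(** * The tangent line of a level curve *)

Lemma is_derive_lincomb (R : realType) (g h : R -> R) (a b t dg dh : R) :
  is_derive t 1 g dg -> is_derive t 1 h dh ->
  is_derive t 1 (fun s => a * g s + b * h s) (a * dg + b * dh).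
Proof.
by move=> gd hd; exact: is_deriveD (is_deriveZ a gd) (is_deriveZ b hd).
Qed.

(** Here fx, fy, fxy, fyy stand for the restrictions to a line of the partial
derivatives of f; the function is the coefficient of the differential equation
in [derivative_zero_along_chord]. *)
Lemma continuous_flex_rate (R : realType) (fx fy fxy fyy : R -> R) (a b s : R) :
  {for s, continuous fx} -> {for s, continuous fy} ->
  {for s, continuous fxy} -> {for s, continuous fyy} -> fy s != 0 ->
  {for s, continuous (fun r => - ((a * fx r + b * fy r) * fyy r
    - 2 * fy r * (a * fxy r + b * fyy r)) * (fy r ^+ 2)^-1)}.
Proof.
move=> cx cy cxy cyy y0.
have lin (g h : R -> R) : {for s, continuous g} -> {for s, continuous h} ->
    {for s, continuous (fun r => a * g r + b * h r)}.
  by move=> cg ch; apply: cvgD; apply: cvgM => //; exact: cvg_cst.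
apply: cvgM; last first.
  by apply: cvgV; [rewrite expf_neq0|exact: (cvgM cy cy)].
apply: cvgN; apply: cvgB; apply: cvgM => //; [exact: lin| |exact: lin].
by apply: cvgM => //; exact: cvg_cst.
Qed.

Lemma dist_lt_of_thirds (R : realType) (z q r b e : R) :
  `|z - q| < e / 3 -> `|z - r| < e / 3 -> `|b| <= `|q - r| -> `|r + b - z| < e.
Proof.
move=> zq zr bqr.
have h1 := ler_normD (r - z) b; have h2 := ler_distD z q r.
rewrite addrAC; rewrite [`|r - z|]distrC in h1; rewrite [`|q - z|]distrC in h2.
lra.
Qed.

Lemma Cn_pred (R : realType) (D : set (R * R)) n (g : R * R -> R) :
  Cn n.+1 D g -> Cn n D g.
Proof.
elim: n g => [|n IHn] g [gc [gd gx gy]]; first exact: (conj gc I).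
exact: (conj gc (And3 gd (IHn _ gx) (IHn _ gy))).
Qed.

Section WebFunction.
Variables (R : realType) (D : set (R * R)).
Hypothesis oD : open D.
Implicit Types (f g u : R * R -> R) (p q v : R * R).

Lemma C1_is_derive_along g p v (t : R) : Cn 1 D g -> D (p + t *: v) ->
  is_derive t 1 (fun s : R => g (p + s *: v))
    (v.1 * pdx g (p + t *: v) + v.2 * pdy g (p + t *: v)).
Proof.
move=> gC1 Dt; have [dg gE] := C1_is_derive v oD gC1 Dt.
by rewrite -gE; exact: is_derive_along.
Qed.

Lemma C2_is_derive2_along f p v (t : R) : Cn 2 D f -> D (p + t *: v) ->
  is_derive t 1
    (fun s : R => v.1 * pdx f (p + s *: v) + v.2 * pdy f (p + s *: v))
    (v.1 ^+ 2 * pdx (pdx f) (p + t *: v)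
     + 2 * v.1 * v.2 * pdy (pdx f) (p + t *: v)
     + v.2 ^+ 2 * pdy (pdy f) (p + t *: v)).
Proof.
move=> fC2 Dt; have [xC yC] := Cn_partials fC2.
have dx := C1_is_derive_along xC Dt; have dy := C1_is_derive_along yC Dt.
have := is_derive_lincomb v.1 v.2 dx dy.
rewrite -(mixed_partials oD fC2 Dt).
move: (pdx (pdx f) _) (pdy (pdx f) _) (pdy (pdy f) _) => fxx fxy fyy.
by move=> /is_derive_eq; apply; ring.
Qed.

(** Every leaf is presented as the chord in a suitable direction v at one of its
points. *)
Lemma linear_level_foliation u :
  (forall p, D p -> exists v, [/\ v != 0,
     forall t, chord D p v t -> u (p + t *: v) = u p
   & forall t, chord D p v t -> \forall q \near p + t *: v,
       D q -> u q = u p -> line_offset p v q = 0]) ->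
  linear_foliation (level_foliation D u).
Proof.
move=> uP _ [p Dp <-]; have [v [v0 u_const u_line]] := uP p Dp.
exists p, v, (chord D p v); split => //.
- by exists 0; exact: chord0.
- exact: open_chord.
- exact: is_interval_chord.
- exact: level_component_chord.
Qed.

Lemma linear_fst_foliation : linear_foliation (level_foliation D fst).
Proof.
apply: linear_level_foliation => p _; exists (0, 1); split.
- by rewrite xpair_eqE oner_eq0 andbF.
- by move=> t _; rewrite /= scaler0 addr0.
- move=> t _; apply: filterS (@filterT _ _ (nbhs_filter _)) => q _ _ /= qp.
  by rewrite /line_offset /= qp subrr mul0r mulr0 subrr.
Qed.

Lemma linear_snd_foliation : linear_foliation (level_foliation D snd).
Proof.
apply: linear_level_foliation => p _; exists (1, 0); split.
- by rewrite xpair_eqE oner_eq0.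
- by move=> t _; rewrite /= scaler0 addr0.
- move=> t _; apply: filterS (@filterT _ _ (nbhs_filter _)) => q _ _ /= qp.
  by rewrite /line_offset /= qp subrr mul0r mulr0 subrr.
Qed.

Definition tangent f p : R * R := (pdy f p, - pdx f p).

Definition flex f p : R :=
  (pdy f p) ^+ 2 * pdx (pdx f) p
  - 2%:R * pdx f p * pdy f p * pdy (pdx f) p
  + (pdx f p) ^+ 2 * pdy (pdy f) p.

(** Let phi = v1 fx + v2 fy along the line. Substituting v1 fx = phi - v2 fy in
v1^2 times the equation [flex f = 0] gives
fy^2 (v1^2 fxx + 2 v1 v2 fxy + v2^2 fyy)
= - phi (phi fyy - 2 fy (v1 fxy + v2 fyy)),
and the bracket on the left is phi'. Since phi(0) = 0 by the choice of v,
phi vanishes identically. *)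
Lemma derivative_zero_along_chord f p t : Cn 2 D f ->
  (forall q, D q -> pdy f q != 0) -> (forall q, D q -> flex f q = 0) ->
  D p -> let v := tangent f p in chord D p v t ->
  v.1 * pdx f (p + t *: v) + v.2 * pdy f (p + t *: v) = 0.
Proof.
move=> fC2 fy0 flex0 Dp v It; have [xC yC] := Cn_partials fC2.
have [xxC xyC] := Cn_partials xC; have [yxC yyC] := Cn_partials yC.
pose phi s := v.1 * pdx f (p + s *: v) + v.2 * pdy f (p + s *: v).
pose a s := - (phi s * pdy (pdy f) (p + s *: v)
  - 2 * pdy f (p + s *: v) * (v.1 * pdy (pdx f) (p + s *: v)
                             + v.2 * pdy (pdy f) (p + s *: v)))
  * (pdy f (p + s *: v) ^+ 2)^-1.
apply: (@linear_ode_zero R phi a _ t (@is_interval_chord _ D p v)) => //.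
- exact: chord0.
- move=> s /chord_sub Ds; apply: is_derive_eq (C2_is_derive2_along fC2 Ds) _.
  have v1 : v.1 != 0 := fy0 p Dp.
  have := fy0 _ Ds; have := flex0 _ Ds; rewrite /flex /a /phi.
  move: (v.1) (v.2) v1 => {}v1 v2 v10.
  move: (pdx f _) (pdy f _) (pdx (pdx f) _) (pdy (pdx f) _) (pdy (pdy f) _).
  move=> fx fy fxx fxy fyy E y0.
  have := congr1 ( *%R (v1 ^+ 2)) E; rewrite mulr0 => {}E.
  apply: (mulfI (expf_neq0 2 y0)); apply/eqP; rewrite -subr_eq0; apply/eqP.
  rewrite -[RHS]E; field; exact: y0.
- move=> s /chord_sub Ds.
  have along n g : Cn n D g -> {for s, continuous (fun r : R => g (p + r *: v))}.
    move=> gC; apply: (@continuous_comp _ _ _ (fun r : R => p + r *: v) g).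
      exact: continuous_line.
    exact: Cn_continuous gC Ds.
  exact: continuous_flex_rate (along _ _ xC) (along _ _ yC) (along _ _ xyC)
    (along _ _ yyC) (fy0 _ Ds).
- rewrite /phi scale0r addr0 /v /=; ring.
Qed.

Lemma const_along_chord f p t : Cn 2 D f ->
  (forall q, D q -> pdy f q != 0) -> (forall q, D q -> flex f q = 0) ->
  D p -> chord D p (tangent f p) t -> f (p + t *: tangent f p) = f p.
Proof.
move=> fC2 fy0 flex0 Dp It; apply/eqP; rewrite -subr_eq0; apply/eqP.
have fC1 : Cn 1 D f by exact: Cn_pred fC2.
apply: (@linear_ode_zero R (fun s => f (p + s *: tangent f p) - f p)
  (fun=> 0) _ t (@is_interval_chord _ D p (tangent f p))) => //.
- exact: chord0.
- move=> s Is; rewrite mul0r -(derivative_zero_along_chord fC2 fy0 flex0 Dp Is).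
  have := C1_is_derive_along fC1 (chord_sub Is).
  move=> /is_deriveB/(_ (is_derive_cst (f p) s 1))/is_derive_eq; apply.
  by rewrite subr0.
- by move=> s _; exact: cvg_cst.
- by rewrite scale0r addr0 subrr.
Qed.

(** Let q be close to a point z of the chord and at the same level. As v is not
vertical, the chord has a point r with the same abscissa as q, also close to z.
By the mean value theorem f q - f r is the difference of the ordinates times a
nonzero value of fy, so f q = f r forces q = r. *)
Lemma level_near_chord f p v t : Cn 1 D f ->
  (forall q, D q -> pdy f q != 0) -> D p -> v.1 != 0 ->
  (forall t, chord D p v t -> f (p + t *: v) = f p) ->
  chord D p v t ->
  \forall q \near p + t *: v, D q -> f q = f p -> line_offset p v q = 0.
Proof.
move=> fC1 fy0 Dp v1 f_const It.
set z := p + t *: v.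
have nD : nbhs z D.
  by apply: open_nbhs_nbhs; split => //; exact: chord_sub.
have [e e0 De] := near_box nD.
(* The vertical segment used below reaches at most |q.2 - y| away from y, in
   both directions; closeness within e / 3 keeps it in the box of radius e. *)
have e30 : 0 < e / 3 by rewrite divr_gt0.
(* The parameter of the point of the line with the abscissa of q. *)
pose s q := (q.1 - p.1) / v.1.
have sz : s z = t.
  by rewrite /s /= /GRing.scale /= addrC addKr mulfK.
have cs : {for z, continuous s}.
  apply: cvgM; last exact: cvg_cst.
  by apply: cvgB; [exact: cvg_fst|exact: cvg_cst].
have ns : \forall q \near z, chord D p v (s q).
  by apply: cs; rewrite sz; apply: open_nbhs_nbhs; split => //; exact: open_chord.
have near_dist (h : R * R -> R) (d : R) : {for z, continuous h} -> 0 < d ->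
  \forall q \near z, `|h z - h q| < d by move=> /cvgrPdist_lt; apply.
have c1 : {for z, continuous (fst : R * R -> R)} by exact: cvg_fst.
have c2 : {for z, continuous (snd : R * R -> R)} by exact: cvg_snd.
have n1 : \forall q \near z, `|z.1 - q.1| < e. by exact: near_dist c1 e0.
have n2 : \forall q \near z, `|z.2 - q.2| < e / 3. by exact: near_dist c2 e30.
have n3 : \forall q \near z, `|z.2 - (p.2 + s q * v.2)| < e / 3.
  have -> : z.2 = p.2 + s z * v.2 by rewrite sz.
  apply: (near_dist (fun q => p.2 + s q * v.2)) => //.
  by apply: cvgD; [exact: cvg_cst|apply: cvgM => //; exact: cvg_cst].
apply: filterS2 (filterI ns n1) (filterI n2 n3).
move=> q [Iq q1] [q2 r2] Dq fq.
pose y := p.2 + s q * v.2.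
have rE : p + s q *: v = (q.1, y).
  congr pair; rewrite /y //= /s /GRing.scale /= divfK//.
  by rewrite addrC subrK.
have upE (b : R) : (q.1, y) + b *: (0, 1) = (q.1, y + b).
  by congr pair; rewrite /= ?scaler0 ?addr0// [b *: _]mulr1.
have bD (b : R) : `|b| <= `|q.2 - y| -> D ((q.1, y) + b *: (0, 1)).
  move=> byq.
  have -> : (q.1, y) + b *: (0, 1) = z + (q.1 - z.1, y + b - z.2).
    by rewrite upE; congr pair; rewrite /= [RHS]addrC subrK.
  by apply: De; [rewrite distrC|exact: dist_lt_of_thirds q2 r2 byq].
have [|b byq] := @mean_value_from0 R
  (fun b : R => f ((q.1, y) + b *: (0, 1)))
  (fun b : R => pdy f ((q.1, y) + b *: (0, 1))) (q.2 - y).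
  move=> b /bD Db; apply: is_derive_along.
  exact: (Cn_derivable fC1 Db).2.
rewrite !upE addr0 [y + (_ - y)]addrC subrK -surjective_pairing fq -rE f_const// subrr.
have Db : D (q.1, y + b) by rewrite -upE; exact: bD.
move=> /esym/eqP; rewrite mulf_eq0 (negbTE (fy0 _ Db)) orbF subr_eq0 => /eqP qy.
by rewrite [q]surjective_pairing qy -rE line_offset0.
Qed.

Lemma derive_locally_const (h : R -> R) (t d : R) (I : set R) : open I -> I t ->
  (forall s, I s -> h s = h t) -> is_derive t 1 h d -> d = 0.
Proof.
move=> oI It h_const [_ <-].
have -> : 'D_1 h t = 'D_1 (cst (h t)) t; last by rewrite derive_cst.
apply: near_eq_derive; apply: filterS h_const _.
by apply: open_nbhs_nbhs.
Qed.

(** Differentiating f twice along the line that carries the leaf: the first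
derivative gives v2 = - v1 fx / fy, hence v1 <> 0, and then the second
derivative is v1^2 / fy^2 times [flex f]. *)
Lemma flex_eq0 f p : Cn 2 D f -> (forall q, D q -> pdy f q != 0) ->
  linear_foliation (level_foliation D f) -> D p -> flex f p = 0.
Proof.
move=> fC2 fy0 lin Dp.
have fC1 : Cn 1 D f by exact: Cn_pred fC2.
set C := connected_component (D `&` [set q | f q = f p]) p.
have [p0 [v [I [v0 _ oI _ CE]]]] : line_piece C by apply: lin; exists p.
have Cp : C p by exact: connected_component_refl.
have IS t : I t -> D (p0 + t *: v) /\ f (p0 + t *: v) = f p.
  move=> It; have : C (p0 + t *: v) by rewrite CE; exists t.
  by move=> /connected_component_sub.
move: Cp; rewrite CE => -[t It pE].
have phi0 s : I s ->
    v.1 * pdx f (p0 + s *: v) + v.2 * pdy f (p0 + s *: v) = 0.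
  move=> Is; have [Ds fs] := IS s Is.
  apply: (derive_locally_const oI Is _ (C1_is_derive_along fC1 Ds)).
  by move=> r /IS[_ ->].
have [Dt _] := IS t It.
have := derive_locally_const oI It _ (C2_is_derive2_along fC2 Dt).
move=> /(_ (fun s Is => etrans (phi0 s Is) (esym (phi0 t It)))).
have := phi0 t It; have := fy0 p Dp.
rewrite /flex pE; move: v0.
have -> : (v != 0) = (v.1 != 0) || (v.2 != 0).
  by rewrite [in LHS](surjective_pairing v) xpair_eqE negb_and.
move: (v.1) (v.2) => a b.
move: (pdx f _) (pdy f _) (pdx (pdx f) _) (pdy (pdx f) _) (pdy (pdy f) _).
move=> fx fy fxx fxy fyy ab0 y0 E1 E2.
have bE : b = - (a * fx) / fy.
  by apply: (mulIf y0); rewrite divfK//; apply/eqP; rewrite -addr_eq0 addrC E1.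
have a0 : a != 0.
  by apply: contraTneq ab0 => a0; rewrite bE a0 mul0r oppr0 mul0r eqxx.
apply: (mulfI (expf_neq0 2 a0)); rewrite mulr0.
have := congr1 ( *%R (fy ^+ 2)) E2; rewrite mulr0 => <-.
by rewrite bE; field.
Qed.

End WebFunction.

Unset Implicit Arguments.
Set Strict Implicit.
Set Printing Implicit Defensive.

Theorem theorem2p2 (R : realType) (D : set (R * R)) (f : R * R -> R)
  (hD : simply_connected_domain D) (hf : smooth D f)
  (hfx : forall p, D p -> pdx f p != 0) (hfy : forall p, D p -> pdy f p != 0) :
  linear_web (web_of D f) <->
  (forall p, D p ->
     (pdy f p) ^+ 2 * pdx (pdx f) p
     - 2%:R * pdx f p * pdy f p * pdy (pdx f) p
     + (pdx f p) ^+ 2 * pdy (pdy f) p = 0).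
Proof.
have [_ oD _ _] := hD; have fC2 := hf 2%N; have fC1 := hf 1%N.
split=> [[_ _ linf] p Dp|flex0].
  exact: (flex_eq0 oD fC2 hfy linf Dp).
split; [exact: linear_fst_foliation|exact: linear_snd_foliation|].
apply: (linear_level_foliation oD) => p Dp.
have f_const t : chord D p (tangent f p) t ->
    f (p + t *: tangent f p) = f p.
  exact: (const_along_chord oD fC2 hfy flex0 Dp).
exists (tangent f p); split => //.
- by rewrite /tangent xpair_eqE negb_and (hfy p Dp).
- move=> t.
  exact: (@level_near_chord _ _ oD f p (tangent f p) t fC1 hfy Dp (hfy p Dp)).
Qed.
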